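(* Let $1 \le n_s < n$ and $m \ge 1$. Let $\{\mathbf{W}(t)\}_{t \geq 0}$ be i.i.d. random $n \times n$ row-stochastic matrices of the block form $$\mathbf{W}(t) = \begin{pmatrix} \mathbf{I}_{n_s} & \mathbf{0} \\ \mathbf{B}(t) & \mathbf{D}(t) \end{pmatrix}, \qquad \overline{\mathbf{W}} = \mathbb{E}\{\mathbf{W}(t)\} = \begin{pmatrix} \mathbf{I}_{n_s} & \mathbf{0} \\ \overline{\mathbf{B}} & \overline{\mathbf{D}} \end{pmatrix},$$ with $\|\overline{\mathbf{D}}\|_2 < 1$ and $\|\overline{\mathbf{D}}\|_2 = \mathbb{E}\{\|\mathbf{D}(t)\|_2\}$. Let $\mathbf{x}(0;s) \in \mathbb{R}^{n \times m}$ and $\mathbf{x}(t+1;s) = \mathbf{W}(t)\mathbf{x}(t;s)$. Observations are $\mathbf{y}(t_i;s) = \mathbf{x}(t_i;s) + \mathbf{n}(t_i;s)$, where the entries of $\mathbf{n}(t_i;s)$ are i.i.d. zero-mean with variance bounded by $\sigma^2$, independent of $\{\mathbf{W}(t)\}$. Given a finite set of distinct sampling times $\mathcal{T}_s$ with $t_i \geq T_o$ for all $t_i \in \mathcal{T}_s$, define $$\hat{\mathbf{x}}(\mathcal{T}_s;s) = \frac{1}{|\mathcal{T}_s|}\sum_{t_i \in \mathcal{T}_s}\mathbf{y}(t_i;s),$$ and let $\overline{\mathbf{x}}(\infty;s) = \lim_{t\to\infty}\mathbb{E}\{\mathbf{x}(t;s)\mid \mathbf{x}(0;s)\} = \overline{\mathbf{W}}^\infty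 \mathbf{x}(0;s)$, where $\overline{\mathbf{W}}^\infty = \begin{pmatrix} \mathbf{I}_{n_s} & \mathbf{0} \\ (\mathbf{I}-\overline{\mathbf{D}})^{-1}\overline{\mathbf{B}} & \mathbf{0}\end{pmatrix}$. Then, as $T_o \to \infty$: (1) the estimator is unbiased: $\mathbb{E}\{\hat{\mathbf{x}}(\mathcal{T}_s;s)\mid\mathbf{x}(0;s)\} = \overline{\mathbf{x}}(\infty;s)$; (2) the estimator is consistent: $\lim_{|\mathcal{T}_s|\to\infty}\mathbb{E}\{\|\hat{\mathbf{x}}(\mathcal{T}_s;s) - \overline{\mathbf{x}}(\infty;s)\|_F^2 \mid \mathbf{x}(0;s)\} = 0$.
   Context: This models randomized DeGroot opinion dynamics on $n$ agents discussing an issue $s$, where the first $n_s$ agents are stubborn (their rows of $\mathbf{W}(t)$ are rows of the identity), each row of $\mathbf{x}(t;s)$ is an agent's opinion vector, and $\mathbf{y}$ are noisy snapshots of opinions. $\|\cdot\|_2$ is the spectral norm and $\|\cdot\|_F$ the Frobenius norm. *)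

(* Defs.v *)
From HB Require Import structures.
From mathcomp Require Import all_boot all_order all_algebra.
From mathcomp Require Import all_classical all_reals all_analysis.

Set Implicit Arguments.
Unset Strict Implicit.
Unset Printing Implicit Defensive.

Import Order.TTheory GRing.Theory Num.Theory.
Local Open Scope classical_set_scope.
Local Open Scope ring_scope.

Section norms.
Context {R : realType}.

Definition vnorm2 {q : nat} (v : 'cV[R]_q) : R := Num.sqrt (\sum_i v i ord0 ^+ 2).

Definition spec_norm {p q : nat} (A : 'M[R]_(p, q)) : R :=
  sup [set vnorm2 (A *m v) | v in [set v : 'cV[R]_q | vnorm2 v = 1]].

Definition frob_norm {p q : nat} (A : 'M[R]_(p, q)) : R :=
  Num.sqrt (\sum_i \sum_j A i j ^+ 2).

End norms.

Section model.
Context {R : realType}.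

Definition Wmat {ns nd : nat} (B : 'M[R]_(nd, ns)) (D : 'M[R]_nd) : 'M[R]_(ns + nd) :=
  block_mx 1%:M 0 B D.

Definition row_stochastic {n : nat} (A : 'M[R]_n) : Prop :=
  (forall i j, 0 <= A i j) /\ (forall i, \sum_j A i j = 1).

Fixpoint traj {n m : nat} (W : nat -> 'M[R]_n) (x0 : 'M[R]_(n, m)) (t : nat)
  : 'M[R]_(n, m) :=
  match t with
  | 0 => x0
  | t'.+1 => W t' *m traj W x0 t'
  end.

Definition xhat {n m : nat} (x N : nat -> 'M[R]_(n, m)) (T : seq nat) : 'M[R]_(n, m) :=
  (size T)%:R^-1 *: \sum_(t <- T) (x t + N t).

Definition Winf {ns nd : nat} (Bbar : 'M[R]_(nd, ns)) (Dbar : 'M[R]_nd) : 'M[R]_(ns + nd) :=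
  block_mx 1%:M 0 (invmx (1%:M - Dbar) *m Bbar) 0.

End model.

Section prob.
Context {R : realType} {d : measure_display} {Omega : measurableType d}.
Variable P : probability Omega R.

Definition mean_mx {p q : nat} (X : Omega -> 'M[R]_(p, q)) : 'M[R]_(p, q) :=
  \matrix_(i, j) fine ('E_P[fun w => X w i j])%E.

Definition rv_events {K : Type} (X : Omega -> K -> R) : set (set Omega) :=
  [set E | exists k (A : set R), measurable A /\ E = (fun w => X w k) @^-1` A].

Definition sigma_of {K : Type} (X : Omega -> K -> R) : set (set Omega) :=
  <<s rv_events X >>.

Definition mutually_independent {I : eqType} (F : I -> set (set Omega)) : Prop :=
  forall (J : seq I) (A : I -> set Omega), uniq J ->
    (forall i, i \in J -> F i (A i)) ->
    P (\big[setI/setT]_(i <- J) A i) = (\prod_(i <- J) P (A i))%E.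

(* cylinder sets of R^K; they generate the product sigma-algebra *)
Definition cylinders (K : Type) : set (set (K -> R)) :=
  [set C | exists k (A : set R), measurable A /\ C = [set f | A (f k)]].

Definition same_law {K : Type} (X Y : Omega -> K -> R) : Prop :=
  forall C, <<s @cylinders K >> C -> P (X @^-1` C) = P (Y @^-1` C).

End prob.

Definition Wvec {R : realType} {Omega : Type} {ns nd : nat}
  (B : Omega -> 'M[R]_(nd, ns)) (D : Omega -> 'M[R]_nd)
  (w : Omega) (k : 'I_(ns + nd) * 'I_(ns + nd)) : R :=
  Wmat (B w) (D w) k.1 k.2.

(* Main.v *)
(**
Rows of W(t) are probability vectors, so the opinions x(t) stay bounded, and
their entries are polynomials in the entries of W(0), ..., W(t-1).  Multiplying
a function of the past by an entry of W(t) therefore multiplies its expectation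
by the corresponding entry of Wbar.  Put z(t) = x(t) - xinf.  Since Wbar fixes
xinf and the stubborn rows of z(t) vanish, the matrix of expectations E[z(t) g],
for g depending on W(0), ..., W(s-1) and t >= s, evolves by multiplication by
Dbar, and so decays like ||Dbar||^(t-s).  With g = 1 this bounds the bias; with
g an entry of z(s) it bounds the autocovariance of z.  These bounds are summable
in |t-s| and the noise is uncorrelated with itself and with z, so the mean square
error is O(1/|T|), uniformly in T_o.
*)
Require Import Defs.
From HB Require Import structures.
From mathcomp Require Import all_boot all_order all_algebra.
From mathcomp Require Import all_classical all_reals all_analysis.
From mathcomp Require Import measurable_realfun.
From mathcomp Require Import ring lra.

Set Implicit Arguments.
Unset Strict Implicit.
Unset Printing Implicit Defensive.

Import Order.TTheory GRing.Theory Num.Theory.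
Import numFieldNormedType.Exports.
Local Open Scope classical_set_scope.
Local Open Scope ring_scope.

(** * Expectations of products over a probability space *)

Section expectation_of_products.
Context (R : realType) (d : measure_display) (Omega : measurableType d).
Variable P : probability Omega R.
Implicit Types f g Y : Omega -> R.

Definition intg f := P.-integrable setT (EFin \o f).

Lemma intg_measurable f : intg f -> measurable_fun setT f.
Proof. by move=> /measurable_int/measurable_EFinP. Qed.

Lemma intgD f g : intg f -> intg g -> intg (fun w => f w + g w).
Proof. by move=> fi gi; exact: integrableD fi gi. Qed.

Lemma intgZ c f : intg f -> intg (fun w => c * f w).
Proof. by move=> fi; exact: integrableZl fi. Qed.

Lemma intg_sum (I : Type) (r : seq I) (F : I -> Omega -> R) :
  (forall i, intg (F i)) -> intg (fun w => \sum_(i <- r) F i w).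
Proof.
move=> Fi; rewrite /intg (_ : _ \o _ = fun w => \sum_(i <- r) (F i w)%:E)%E.
  by apply: integrable_sum => // i _; exact: Fi.
by apply/funext => w /=; rewrite sumEFin.
Qed.

Lemma intg_mul_bounded c f g : intg f -> measurable_fun setT g ->
  (forall w, `|g w| <= c) -> intg (fun w => f w * g w).
Proof.
move=> fi mg gc; apply: (integrableMl measurableT fi mg).
exists c; split; first exact: num_real.
by move=> x cx w _ /=; rewrite (le_trans (gc w))// ltW.
Qed.

Lemma intg_cst c : intg (fun=> c).
Proof. exact: (finite_measure_integrable_cst P c). Qed.

Lemma intg_bounded c g : measurable_fun setT g ->
  (forall w, `|g w| <= c) -> intg g.
Proof.
move=> mg gc; have := intg_mul_bounded (intg_cst 1) mg gc.
by congr (intg _); apply/funext => w; rewrite mul1r.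
Qed.

Lemma intg_mul_indic f (A : set Omega) : intg f -> measurable A ->
  intg (fun w => f w * \1_A w).
Proof.
move=> fi mA; refine (intg_mul_bounded fi (measurable_indic mA) _).
by move=> w; rewrite indicE; case: (w \in A); rewrite ?normr1 ?normr0.
Qed.

Lemma Rintegral_ext f g : f =1 g -> \int[P]_w f w = \int[P]_w g w.
Proof. by move=> fg; apply: eq_Rintegral => w _. Qed.

Lemma Rintegral_sum (I : Type) (r : seq I) (F : I -> Omega -> R) :
  (forall i, intg (F i)) ->
  \int[P]_w (\sum_(i <- r) F i w) = \sum_(i <- r) \int[P]_w F i w.
Proof.
move=> Fi; elim: r => [|i r IH].
  rewrite big_nil (Rintegral_ext (g := fun=> 0)); last by move=> w; rewrite big_nil.
  by rewrite Rintegral_cst// mul0r.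
rewrite big_cons -IH -RintegralD//; [|exact: Fi|exact: intg_sum].
by apply: Rintegral_ext => w; rewrite big_cons.
Qed.

Lemma Rintegral_indic {A : set Omega} : measurable A ->
  \int[P]_w \1_A w = fine (P A).
Proof. by move=> mA; rewrite /Rintegral integral_indic// setIT. Qed.

Lemma Rintegral_cst1 c : \int[P]_w c = c.
Proof. by rewrite Rintegral_cst//= (@probability_setT _ _ _ P) mulr1. Qed.

Import HBNNSimple.

(** A simple function of [Y] is a finite combination of indicators of events that [Y] lies in a
    Borel set, so the hypothesis on such events extends by linearity. *)
Lemma Rintegral_mul_sfun f Y (h : {nnsfun R >-> R}) :
  intg f -> measurable_fun setT Y ->
  (forall B : set R, measurable B ->
     \int[P]_w (f w * \1_(Y @^-1` B) w) = \int[P]_w f w * fine (P (Y @^-1` B))) ->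
  \int[P]_w (f w * h (Y w)) = \int[P]_w f w * \int[P]_w h (Y w).
Proof.
move=> fi mY fY.
have [c [N hE]] : exists c : nat -> R, exists N : nat, forall w,
    h (Y w) = \sum_(i < N) c i * \1_(Y @^-1` (h @^-1` [set c i])) w.
  by do 2 eexists; move=> w; exact: fimfunEord.
have mB i : measurable (h @^-1` [set c i]).
  by rewrite -[X in measurable X]setTI; exact: measurable_funP.
have mYB i : measurable (Y @^-1` (h @^-1` [set c i])).
  by rewrite -[X in measurable X]setTI; exact: mY.
have i1 i : intg (\1_(Y @^-1` (h @^-1` [set c i]))).
  exact: integrable_indic.
transitivity (\sum_(i < N)
    \int[P]_w (c i * (f w * \1_(Y @^-1` (h @^-1` [set c i])) w))).
  rewrite -Rintegral_sum => [|i]; last first.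
    exact/intgZ/intg_mul_indic.
  apply: Rintegral_ext => w; rewrite hE mulr_sumr.
  by apply: eq_bigr => i _; rewrite mulrCA.
rewrite [in RHS](Rintegral_ext hE) Rintegral_sum => [|i]; last exact/intgZ/i1.
rewrite mulr_sumr; apply: eq_bigr => i _.
rewrite !RintegralZl//; [|exact: i1|exact: intg_mul_indic].
by rewrite fY// Rintegral_indic// mulrCA.
Qed.

Lemma Rintegral_cvg (u : nat -> Omega -> R) f g :
  (forall n, measurable_fun setT (u n)) -> measurable_fun setT f -> intg g ->
  (forall w, u n w @[n --> \oo] --> f w) ->
  (forall n w, `|u n w| <= g w) ->
  \int[P]_w u n w @[n --> \oo] --> \int[P]_w f w.
Proof.
move=> mu mf gi uf ug.
have [||||fi _ cv] := @dominated_convergence _ _ _ P setT measurableT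
    (fun n w => (u n w)%:E) (EFin \o f) (EFin \o g) _ _ _ gi.
- by move=> n; exact/measurable_EFinP.
- exact/measurable_EFinP.
- by apply: aeW => w _; apply: cvg_EFin (uf w); exact: nearW.
- by apply: aeW => w n _; rewrite lee_fin.
rewrite -(fineK (integrable_fin_num measurableT fi)) in cv.
exact: fine_cvg cv.
Qed.

(* [phi] is the positive or the negative part: both are dominated by [|y|]. *)
Lemma Rintegral_mul_comp f Y (phi : R -> R) :
  intg f -> measurable_fun setT Y -> measurable_fun setT phi ->
  (forall y, 0 <= phi y <= `|y|) -> intg Y -> intg (fun w => f w * Y w) ->
  (forall B : set R, measurable B ->
     \int[P]_w (f w * \1_(Y @^-1` B) w) = \int[P]_w f w * fine (P (Y @^-1` B))) ->
  \int[P]_w (f w * phi (Y w)) = \int[P]_w f w * \int[P]_w phi (Y w).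
Proof.
move=> fi mY mphi phiY Yi fYi fY.
have mEphi : measurable_fun setT (EFin \o phi) by exact/measurable_EFinP.
have phi0 y : [set: R] y -> (0 <= (EFin \o phi) y)%E.
  by move=> _; rewrite lee_fin; case/andP: (phiY y).
(* Simple functions increasing to [phi] stay below it, hence below the absolute value; this supplies
   the dominating functions [|f Y|] and [|Y|] for the two limits. *)
pose h n := nnsfun_approx measurableT mEphi n.
have hphi y : h n y @[n --> \oo] --> phi y.
  exact: (fine_cvg (cvg_nnsfun_approx measurableT mEphi phi0 (x := y) I)).
have hle n y : `|h n y| <= `|y|.
  rewrite ger0_norm; last exact: fun_ge0.
  have /andP[_] := phiY y; apply: le_trans.
  rewrite -lee_fin /h nnsfun_approxE.
  exact: (le_approx n phi0 (x := y) I).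
have mhY n : measurable_fun setT (fun w => h n (Y w)).
  by apply: measurableT_comp mY; exact: measurable_funP.
have mphiY : measurable_fun setT (fun w => phi (Y w)) by exact: measurableT_comp mY.
have mf := intg_measurable fi.
have cv1 : \int[P]_w (f w * h n (Y w)) @[n --> \oo] --> \int[P]_w (f w * phi (Y w)).
  apply: (@Rintegral_cvg _ _ (fun w => `|f w * Y w|)).
  - by move=> n; exact: measurable_funM.
  - exact: measurable_funM.
  - exact: integrable_norm fYi.
  - by move=> w; apply: cvgMr.
  - by move=> n w; rewrite !normrM ler_wpM2l.
have cv2 : \int[P]_w f w * \int[P]_w h n (Y w) @[n --> \oo] -->
    \int[P]_w f w * \int[P]_w phi (Y w).
  apply: cvgMr; apply: (@Rintegral_cvg _ _ (fun w => `|Y w|)) => //.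
  exact: integrable_norm Yi.
have E : (fun n => \int[P]_w (f w * h n (Y w))) =
    (fun n => \int[P]_w f w * \int[P]_w h n (Y w)).
  by apply/funext => n; exact: Rintegral_mul_sfun.
by rewrite E in cv1; exact: cvg_unique cv1 cv2.
Qed.

(** Only [f] itself, rather than functions of [f], has to factor against the events of [Y]. The rule
    passes from events to [Y] through its positive and negative parts. *)
Lemma Rintegral_mul f Y : intg f -> intg Y -> intg (fun w => f w * Y w) ->
  (forall B : set R, measurable B ->
     \int[P]_w (f w * \1_(Y @^-1` B) w) = \int[P]_w f w * fine (P (Y @^-1` B))) ->
  \int[P]_w (f w * Y w) = \int[P]_w f w * \int[P]_w Y w.
Proof.
move=> fi Yi fYi fY.
have mY := intg_measurable Yi.
have mp : measurable_fun setT (fun y : R => Num.max y 0) by exact: measurable_maxr.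
have mn : measurable_fun setT (fun y : R => Num.max (- y) 0).
  exact: measurable_maxr.
have pE (y : R) : 0 <= Num.max y 0 <= `|y|.
  by rewrite le_max lexx orbT ge_max ler_norm normr_ge0.
have nE (y : R) : 0 <= Num.max (- y) 0 <= `|y|.
  by rewrite -normrN; exact: pE.
have Yp w : Y w = Num.max (Y w) 0 - Num.max (- Y w) 0.
  by case: (leP (Y w) 0) => Y0; case: (leP (- Y w) 0); lra.
have dom (g : Omega -> R) (phi : R -> R) : measurable_fun setT g ->
    intg (fun w => g w * Y w) -> measurable_fun setT phi ->
    (forall y, 0 <= phi y <= `|y|) -> intg (fun w => g w * phi (Y w)).
  move=> mg gi mphi phiY; apply: le_integrable gi => //.
    by apply/measurable_EFinP/measurable_funM => //; exact: measurableT_comp mY.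
  move=> w _; rewrite lee_fin !normrM ler_wpM2l//.
  by have /andP[p0 pY] := phiY (Y w); rewrite ger0_norm.
have dom1 (phi : R -> R) : measurable_fun setT phi ->
    (forall y, 0 <= phi y <= `|y|) -> intg (fun w => phi (Y w)).
  move=> mphi phiY.
  rewrite (_ : (fun _ => _) = fun w => 1 * phi (Y w)); last first.
    by apply/funext => w; rewrite mul1r.
  apply: dom => //; rewrite (_ : (fun _ => _) = Y)//.
  by apply/funext => w; rewrite mul1r.
have mf := intg_measurable fi.
rewrite (Rintegral_ext (g := fun w => f w * Num.max (Y w) 0 - f w * Num.max (- Y w) 0)); last first.
  by move=> w; rewrite [in LHS]Yp mulrBr.
rewrite RintegralB//; [|exact: (dom f (fun y => Num.max y 0))|
  exact: (dom f (fun y => Num.max (- y) 0))].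
rewrite (Rintegral_mul_comp (phi := fun y => Num.max y 0))//.
rewrite (Rintegral_mul_comp (phi := fun y => Num.max (- y) 0))//.
rewrite -mulrBr -RintegralB//; [|exact: (dom1 (fun y => Num.max y 0))|
  exact: (dom1 (fun y => Num.max (- y) 0))].
by congr (_ * _); apply: Rintegral_ext => w; rewrite -Yp.
Qed.

End expectation_of_products.

(** * Functions that factor against independent classes of events *)

Section decoupled.
Context (R : realType) (d : measure_display) (Omega : measurableType d).
Variable P : probability Omega R.
Context (I : eqType) (F : I -> set (set Omega)).
Hypothesis F_measurable : forall i A, F i A -> measurable A.
Hypothesis F_indep : mutually_independent P F.
Implicit Types (f g Y : Omega -> R) (K : pred I).

(** Weaker than independence of [f] from the [F i], [i] outside [K], but stable
    under linear combinations, so that it passes to polynomials in the entries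
    of the random matrices. *)
Definition decoupled K f : Prop := intg P f /\
  forall (J : seq I) (A : I -> set Omega), uniq J ->
    (forall i, i \in J -> ~~ K i) -> (forall i, i \in J -> F i (A i)) ->
    \int[P]_w (f w * \1_(\big[setI/setT]_(i <- J) A i) w) =
    \int[P]_w f w * fine (P (\big[setI/setT]_(i <- J) A i)).

Lemma bigcap_measurable_seq (J : seq I) (A : I -> set Omega) :
  (forall i, i \in J -> F i (A i)) -> measurable (\big[setI/setT]_(i <- J) A i).
Proof.
move=> FA; rewrite big_seq; elim/big_ind : _ => //; first exact: measurableI.
by move=> i /FA; exact: F_measurable.
Qed.
Arguments bigcap_measurable_seq {J A}.

Lemma decoupled_cst K c : decoupled K (fun=> c).
Proof.
split; first exact: intg_cst.
move=> J A _ _ FA; have mA := bigcap_measurable_seq FA.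
rewrite RintegralZl//; last exact: integrable_indic.
by rewrite Rintegral_indic// Rintegral_cst1.
Qed.

Lemma decoupledD K f g :
  decoupled K f -> decoupled K g -> decoupled K (fun w => f w + g w).
Proof.
move=> [fi fK] [gi gK]; split; first exact: intgD.
move=> J A uJ JK FA; have mA := bigcap_measurable_seq FA.
rewrite RintegralD// mulrDl -fK// -gK// -RintegralD//; [|exact: intg_mul_indic..].
by apply: Rintegral_ext => w; rewrite mulrDl.
Qed.

Lemma decoupledZ c K f : decoupled K f -> decoupled K (fun w => c * f w).
Proof.
move=> [fi fK]; split; first exact: intgZ.
move=> J A uJ JK FA; have mA := bigcap_measurable_seq FA.
rewrite RintegralZl// -mulrA -fK// -RintegralZl//; last exact: intg_mul_indic.
by apply: Rintegral_ext => w; rewrite mulrA.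
Qed.

Lemma decoupled_ext K f g : f =1 g -> decoupled K f -> decoupled K g.
Proof. by move=> /funext ->. Qed.

Lemma decoupled_sum K (T : Type) (r : seq T) (f : T -> Omega -> R) :
  (forall i, decoupled K (f i)) -> decoupled K (fun w => \sum_(i <- r) f i w).
Proof.
move=> fK; elim: r => [|i r IH].
  by apply: decoupled_ext (decoupled_cst K 0) => w; rewrite big_nil.
by apply: decoupled_ext (decoupledD (fK i) IH) => w; rewrite big_cons.
Qed.

Lemma decoupledW {K K' : pred I} f :
  (forall i, K i -> K' i) -> decoupled K f -> decoupled K' f.
Proof.
move=> KK' [fi fK]; split => // J A uJ JK' FA.
by apply: fK => // i /JK'; apply/contra/KK'.
Qed.

(** The product rule is applied to [f] times the indicator of an event [S] with indices outside [K]
    and other than [i]: intersecting [S] with an event of [Y] gives again an intersection of events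
    outside [K]. General [S] gives the decoupling of the product, and the whole space gives its
    expectation. *)
Lemma decoupled_mul K f i Y : decoupled K f -> ~~ K i ->
  (forall B : set R, measurable B -> F i (Y @^-1` B)) ->
  intg P Y -> intg P (fun w => f w * Y w) ->
  decoupled (predU1 i K) (fun w => f w * Y w) /\
  \int[P]_w (f w * Y w) = \int[P]_w f w * \int[P]_w Y w.
Proof.
move=> [fi fK] iK FY Yi fYi.
have key (J : seq I) (A : I -> set Omega) : uniq J ->
    (forall j, j \in J -> ~~ predU1 i K j) -> (forall j, j \in J -> F j (A j)) ->
    \int[P]_w (f w * Y w * \1_(\big[setI/setT]_(j <- J) A j) w) =
    \int[P]_w f w * \int[P]_w Y w * fine (P (\big[setI/setT]_(j <- J) A j)).
  move=> uJ JK FA; have mA := bigcap_measurable_seq FA.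
  set S := \big[setI/setT]_(j <- J) A j.
  have iJ : i \notin J by apply/negP => /JK; rewrite /= eqxx.
  have JK' j : j \in J -> ~~ K j by move=> /JK /=; rewrite negb_or => /andP[].
  have fSi : intg P (fun w => f w * \1_S w) by exact: intg_mul_indic.
  have -> : \int[P]_w (f w * Y w * \1_S w) = \int[P]_w (f w * \1_S w * Y w).
    by apply: Rintegral_ext => w; rewrite mulrAC.
  rewrite Rintegral_mul//.
  - by rewrite fK// mulrAC.
  - rewrite (_ : (fun _ => _) = fun w => f w * Y w * \1_S w).
      exact: intg_mul_indic.
    by apply/funext => w; rewrite mulrAC.
  (* [A'] puts the event of [Y] at index [i], so that the hypothesis on [f] and the independence
     both apply to the single duplicate-free list [i :: J]. *)
  move=> B mB; pose A' j := if j == i then Y @^-1` B else A j.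
  have A'J : \big[setI/setT]_(j <- J) A' j = S.
    apply: eq_big_seq => j jJ; rewrite /A'; case: eqP => // ji.
    by move: iJ; rewrite -ji jJ.
  have FA' j : j \in i :: J -> F j (A' j).
    rewrite inE /A'; case: eqP => [-> _|_ /=]; last exact: FA.
    exact: FY.
  have uJ' : uniq (i :: J) by rewrite /= iJ.
  have capE : \big[setI/setT]_(j <- i :: J) A' j = Y @^-1` B `&` S.
    by rewrite big_cons A'J /A' eqxx.
  have PcapE : P (Y @^-1` B `&` S) = (P (Y @^-1` B) * P S)%E.
    rewrite -capE F_indep// big_cons {1}/A' eqxx; congr (_ * _)%E.
    rewrite -A'J F_indep// => j jJ; apply: FA'.
    by rewrite inE jJ orbT.
  have := fK (i :: J) A' uJ'; rewrite capE => fK'.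
  transitivity (\int[P]_w (f w * \1_(Y @^-1` B `&` S) w)).
    by apply: Rintegral_ext => w; rewrite indicI -mulrA; congr (_ * _); exact: mulrC.
  rewrite fK'//; last first.
    by move=> j; rewrite inE => /predU1P[->|/JK'].
  rewrite fK// PcapE fineM ?fin_num_measure//; first by rewrite [_ * fine (P S)]mulrC mulrA.
  exact: F_measurable (FY _ mB).
have E : \int[P]_w (f w * Y w) = \int[P]_w f w * \int[P]_w Y w.
  have := key [::] (fun=> setT) isT; rewrite big_nil (@probability_setT _ _ _ P) mulr1 => <-//.
  by apply: Rintegral_ext => w; rewrite indicT mulr1.
by split=> //; split => // J A uJ JK FA; rewrite key// E.
Qed.

(** Starting from the constant 1, [decoupled_mul] adjoins first [X] and then [Y]. *)
Lemma Rintegral_mul_indep i j X Y : i != j ->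
  (forall B : set R, measurable B -> F i (X @^-1` B)) ->
  (forall B : set R, measurable B -> F j (Y @^-1` B)) ->
  intg P X -> intg P Y -> intg P (fun w => X w * Y w) ->
  \int[P]_w (X w * Y w) = \int[P]_w X w * \int[P]_w Y w.
Proof.
move=> ij FX FY Xi Yi XYi.
have X1 : (fun w => 1 * X w) = X by apply/funext => w; rewrite mul1r.
have [|h _] := decoupled_mul (f := fun=> 1) (K := pred0) (decoupled_cst _ _) isT FX Xi.
  by rewrite X1.
rewrite X1 in h; have [|_ //] := decoupled_mul h _ FY Yi XYi.
by rewrite /= orbF eq_sym.
Qed.

End decoupled.

(** * Euclidean and spectral norms *)

Section spectral_norm.
Context {R : realType}.

Lemma vnorm2_ge0 q (v : 'cV[R]_q) : 0 <= vnorm2 v.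
Proof. exact: sqrtr_ge0. Qed.

Lemma ler_abs_vnorm2 q (v : 'cV[R]_q) i : `|v i ord0| <= vnorm2 v.
Proof.
rewrite -sqrtr_sqr ler_sqrt; last by apply: sumr_ge0 => k _; exact: sqr_ge0.
by rewrite (bigD1 i)//= lerDl; apply: sumr_ge0 => k _; exact: sqr_ge0.
Qed.

Lemma vnorm2Z q a (v : 'cV[R]_q) : vnorm2 (a *: v) = `|a| * vnorm2 v.
Proof.
rewrite /vnorm2 -sqrtr_sqr -sqrtrM ?sqr_ge0// mulr_sumr.
by congr Num.sqrt; apply: eq_bigr => i _; rewrite mxE exprMn.
Qed.

Lemma vnorm2_eq0 q {v : 'cV[R]_q} : vnorm2 v = 0 -> v = 0.
Proof.
move=> v0; apply/colP => i; rewrite mxE; apply/eqP; rewrite -normr_le0 -v0.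
exact: ler_abs_vnorm2.
Qed.

Lemma vnorm2_le q c (v : 'cV[R]_q) : 0 <= c -> (forall i, `|v i ord0| <= c) ->
  vnorm2 v <= Num.sqrt q%:R * c.
Proof.
move=> c0 vc; rewrite -[X in _ * X]ger0_norm// -sqrtr_sqr -sqrtrM ?ler0n//.
rewrite /vnorm2 ler_sqrt; last by rewrite mulr_ge0 ?sqr_ge0.
rewrite -[q in leRHS]card_ord -sum1_card natr_sum mulr_suml.
apply: ler_sum => i _; rewrite mul1r.
by rewrite -real_normK ?num_real// lerXn2r ?nnegrE.
Qed.

Lemma vnorm2_mulmx_le p q (A : 'M[R]_(p, q)) v :
  vnorm2 (A *m v) <= spec_norm A * vnorm2 v.
Proof.
have [v0|v0] := eqVneq (vnorm2 v) 0.
  rewrite v0 mulr0 (vnorm2_eq0 v0) mulmx0 /vnorm2 big1 ?sqrtr0// => i _.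
  by rewrite mxE expr0n.
set u := (vnorm2 v)^-1 *: v.
have u1 : vnorm2 u = 1.
  by rewrite vnorm2Z ger0_norm ?invr_ge0 ?vnorm2_ge0// mulVf.
have vE : v = vnorm2 v *: u by rewrite scalerA mulfV// scale1r.
rewrite [X in A *m X]vE -scalemxAr vnorm2Z ger0_norm ?vnorm2_ge0//.
rewrite mulrC ler_wpM2r ?vnorm2_ge0//.
apply: ub_le_sup; last by exists u.
(* A crude bound by the entries: the supremum defining [spec_norm] is an upper bound only once the
   set is known to be bounded. *)
exists (Num.sqrt p%:R * \sum_i \sum_j `|A i j|) => _ [w w1 <-].
apply: vnorm2_le => [|i].
  by apply: sumr_ge0 => i _; apply: sumr_ge0 => j _.
rewrite (bigD1 i)//= mxE; apply: (@le_trans _ _ (\sum_j `|A i j|)); last first.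
  by rewrite lerDl; apply: sumr_ge0 => k _; apply: sumr_ge0 => j _.
apply: le_trans (ler_norm_sum _ _ _) _; apply: ler_sum => j _.
by rewrite normrM ler_piMr// -w1 ler_abs_vnorm2.
Qed.

Lemma spec_norm_ge0 p q (A : 'M[R]_(p, q)) : (0 < q)%N -> 0 <= spec_norm A.
Proof.
move=> q0; pose v : 'cV[R]_q := const_mx 1.
have v0 : 0 < vnorm2 v.
  by have := ler_abs_vnorm2 v (Ordinal q0); rewrite mxE normr1; apply: lt_le_trans.
by rewrite -(pmulr_lge0 _ v0); apply: le_trans (vnorm2_mulmx_le A v); exact: vnorm2_ge0.
Qed.

(** If [1 - A] were singular, [A] would fix a nonzero vector, which a norm below 1 forbids. *)
Lemma unitmx_1B q (A : 'M[R]_q) : spec_norm A < 1 -> 1%:M - A \in unitmx.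
Proof.
move=> A1; rewrite unitmxE unitfE -det_tr; apply/det0P => -[v v0 vA].
have Av : A *m v^T = v^T.
  apply/eqP; rewrite eq_sym -subr_eq0 -{1}(mul1mx v^T) -mulmxBl.
  by rewrite -[X in X == _]trmxK trmx_mul trmxK vA trmx0.
have := vnorm2_mulmx_le A v^T; rewrite Av.
have [/vnorm2_eq0 v0'|vn0] := eqVneq (vnorm2 v^T) 0.
  by move: v0; rewrite -[v]trmxK v0' trmx0 eqxx.
by rewrite ler_pMl ?lt0r ?vn0 ?vnorm2_ge0// leNgt A1.
Qed.

End spectral_norm.

(** * Fixed point and contraction of the mean dynamics *)

Section fixed_point.
Context {R : realType} {ns nd m : nat} (B : 'M[R]_(nd, ns)) (D : 'M[R]_nd).
Hypothesis D1 : spec_norm D < 1.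

(** In the lower left block the claim is [B = (1 - D) (1 - D)^-1 B]. *)
Lemma Wmat_Winf : Wmat B D *m Winf B D = Winf B D.
Proof.
rewrite /Wmat /Winf mulmx_block !mul1mx !mul0mx !mulmx0 mulmx1 !addr0.
congr block_mx; apply/eqP; rewrite -subr_eq0 -addrA -{2}(mul1mx (invmx _ *m _)).
by rewrite -mulmxBl -opprB mulNmx mulmxA mulmxV ?unitmx_1B// mul1mx subrr.
Qed.

Hypothesis nd_gt0 : (0 < nd)%N.

(** Vanishing stubborn rows stay zero, so the lower block evolves by [D] alone and each of its
    columns shrinks in Euclidean norm. The factor [sqrt nd] converts the initial entrywise bound
    into a Euclidean one. *)
Lemma Wmat_contraction {Z : nat -> 'M[R]_(ns + nd, m)} c : 0 <= c ->
  (forall k, Z k.+1 = Wmat B D *m Z k) -> usubmx (Z 0) = 0 ->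
  (forall i j, `|Z 0 i j| <= c) ->
  forall k i j, `|Z k i j| <= Num.sqrt nd%:R * c * spec_norm D ^+ k.
Proof.
move=> c0 ZS uZ0 Zc k i j.
have uZ l : usubmx (Z l) = 0.
  elim: l => [|l IH]; first exact: uZ0.
  by rewrite ZS /Wmat -[Z l]vsubmxK mul_block_col col_mxKu mul1mx mul0mx addr0.
have dZ l : dsubmx (Z l.+1) = D *m dsubmx (Z l).
  have ZE : Z l = col_mx 0 (dsubmx (Z l)) by rewrite -[LHS]vsubmxK uZ.
  by rewrite ZS {1}ZE /Wmat mul_block_col col_mxKd mulmx0 add0r.
have s0 := spec_norm_ge0 D nd_gt0.
have dZk : vnorm2 (col j (dsubmx (Z k))) <= Num.sqrt nd%:R * c * spec_norm D ^+ k.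
  elim: k => [|k IH].
    by rewrite expr0 mulr1; apply: vnorm2_le => // l; rewrite !mxE.
  rewrite dZ colE -mulmxA -colE exprS mulrCA.
  by apply: le_trans (vnorm2_mulmx_le _ _) _; rewrite ler_wpM2l.
rewrite -[Z k]vsubmxK uZ; case: (split_ordP i) => i' ->.
  by rewrite col_mxEu mxE normr0 !mulr_ge0 ?exprn_ge0.
rewrite col_mxEd; apply: le_trans dZk.
by have := ler_abs_vnorm2 (col j (dsubmx (Z k))) i'; rewrite mxE.
Qed.

End fixed_point.

(** * Geometric sums over distances between sampling times *)

Section geometric_sums.
Context {R : realType} (q : R).
Hypotheses (q0 : 0 <= q) (q1 : q < 1).

Lemma sum_expr_le n : \sum_(k < n) q ^+ k <= (1 - q)^-1.
Proof.
rewrite -[leRHS]mul1r ler_pdivlMr ?subr_gt0//.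
suff -> : (\sum_(k < n) q ^+ k) * (1 - q) = 1 - q ^+ n by rewrite lerBlDr lerDl exprn_ge0.
elim: n => [|n IH]; first by rewrite big_ord0 expr0 mul0r subrr.
by rewrite big_ord_recr/= mulrDl IH exprS; ring.
Qed.

(** With truncated subtraction the exponent is the distance between [t] and [s]. Each distance
    occurs at most twice among distinct times, once on either side of [t]. *)
Lemma sum_expr_dist_le (T : seq nat) t : uniq T ->
  \sum_(s <- T) q ^+ ((t - s) + (s - t)) <= 2 / (1 - q).
Proof.
move=> uT; pose M := \max_(s <- T) s; pose a s := q ^+ ((t - s) + (s - t)).
have a0 s : 0 <= a s by exact: exprn_ge0.
have TM s : s \in T -> (s < t.+1 + M)%N.
  move=> sT; rewrite addSn ltnS (leq_trans _ (leq_addl _ _))//.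
  exact: leq_bigmax_seq.
(* The sum is enlarged to all times of an initial segment containing [T] and [t], then split just
   after [t]. *)
have sub : \sum_(s <- T) a s <= \sum_(0 <= s < t.+1 + M) a s.
  rewrite [leRHS](bigID (mem T))/= -[leLHS]addr0 lerD ?sumr_ge0//.
  rewrite -[leRHS]big_filter; set T' := [seq _ <- _ | _].
  rewrite (perm_big T')//; apply: uniq_perm => //.
    by rewrite filter_uniq// iota_uniq.
  move=> s; rewrite mem_filter mem_index_iota /=.
  by case: (boolP (s \in T)) => // /TM ->.
apply: le_trans sub _.
rewrite (big_cat_nat (n := t.+1)) ?leq_addr//= mulr_natl mulr2n lerD//.
  rewrite big_nat_rev big_mkord /=.
  apply: le_trans (sum_expr_le t.+1); apply: ler_sum => i _.
  have /eqP it : (t - i - t == 0)%N by rewrite subn_eq0 leq_subr.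
  by rewrite /a add0n subSS it addn0 subKn// -ltnS.
rewrite -{1}[t.+1]add0n big_addn addKn big_mkord.
apply: le_trans (sum_expr_le M); apply: ler_sum => i _.
have /eqP it : (t - (i + t.+1) == 0)%N by rewrite subn_eq0 addnS -addSn leq_addl.
(* Beyond [t] the distances start at 1, and the extra factor [q] is at most 1. *)
by rewrite /a it add0n addnS -addSn addnK exprS ler_piMl ?exprn_ge0// ltW.
Qed.

End geometric_sums.

(** * Sigma-algebras generated by families of variables *)

Section sigma_of.
Context (R : realType) (d : measure_display) (Omega : measurableType d).
Context (K : Type) (X : Omega -> K -> R).

Lemma sigma_of_measurable (A : set Omega) :
  (forall k, measurable_fun setT (fun w => X w k)) -> sigma_of X A -> measurable A.
Proof.
move=> mX; apply: smallest_sub; first exact: sigma_algebra_measurable.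
by move=> _ [k [B [mB ->]]]; rewrite -[X in measurable X]setTI; exact: mX.
Qed.

Let measurable_sigma_of k :
  @measurable_fun _ _ (g_sigma_algebraType (rv_events X)) _ setT (fun w => X w k).
Proof. by move=> _ B mB; rewrite setTI; apply: sub_sigma_algebra; exists k, B. Qed.

Lemma sigma_of_preimage k (B : set R) : measurable B ->
  sigma_of X ((fun w => X w k) @^-1` B).
Proof. by move=> mB; apply: sub_sigma_algebra; exists k, B. Qed.

(** Second moments of the opinions involve products of two entries of the same random matrix. *)
Lemma sigma_of_preimageM k l (B : set R) : measurable B ->
  sigma_of X ((fun w => X w k * X w l) @^-1` B).
Proof.
move=> mB; rewrite -[X in sigma_of _ X]setTI.
exact: (measurable_funM (measurable_sigma_of k) (measurable_sigma_of l)).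
Qed.

End sigma_of.

(** * Moments along the random trajectories *)

Section trajectories.
Context (R : realType) (d : measure_display) (Omega : measurableType d).
Variable P : probability Omega R.
Context (n m : nat) (J : eqType) (G : J -> set (set Omega)).
Variables (W : nat -> Omega -> 'M[R]_n) (x0 : 'M[R]_(n, m)) (Wbar : 'M[R]_n).

(** [J] and [G] stand for sources of events besides the matrices; they are instantiated with the
    noise entries. *)
Definition gens (a : nat + J) : set (set Omega) :=
  match a with
  | inl t => sigma_of (fun w (k : 'I_n * 'I_n) => W t w k.1 k.2)
  | inr j => G j
  end.

Hypothesis W_measurable : forall t i j, measurable_fun setT (fun w => W t w i j).
Hypothesis W_stochastic : forall t w, row_stochastic (W t w).
Hypothesis gens_indep : mutually_independent P gens.
Hypothesis gens_measurable : forall a A, gens a A -> measurable A.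
Hypothesis W_mean : forall t i j, \int[P]_w W t w i j = Wbar i j.

Let x t w := traj (fun s => W s w) x0 t.
Let c := \sum_i \sum_j `|x0 i j|.

(** No index of [J] is ever past, so decoupling from the future includes decoupling from the
    noise. *)
Definition past t : pred (nat + J) := fun a => if a is inl r then (r < t)%N else false.

Notation indep_of_future t := (decoupled P gens (past t)).
Notation integrable_rv := (intg P).

Lemma W_le1 t w i j : `|W t w i j| <= 1.
Proof.
have [W0 W1] := W_stochastic t w; rewrite ger0_norm// -(W1 i) (bigD1 j)//= lerDl.
exact: sumr_ge0.
Qed.

Lemma traj_le t w i j : `|x t w i j| <= c.
Proof.
elim: t i => [|t IH] i /=.
  rewrite /c (bigD1 i)//= (bigD1 j)//= -addrA lerDl addr_ge0 ?sumr_ge0// => k _.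
  exact: sumr_ge0.
have [W0 W1] := W_stochastic t w.
rewrite mxE (le_trans (ler_norm_sum _ _ _))// -[c]mul1r -(W1 i) mulr_suml.
by apply: ler_sum => k _; rewrite normrM ger0_norm// ler_wpM2l.
Qed.

Lemma W_integrable t i j : integrable_rv (fun w => W t w i j).
Proof. by apply: (intg_bounded P (c := 1)) => // w; exact: W_le1. Qed.

Lemma past_notin t : ~~ past t (inl t).
Proof. by rewrite /= ltnn. Qed.

Lemma pastS t a : predU1 (inl t) (past t) a -> past t.+1 a.
Proof.
case: a => [r|j] /predU1P[]//=; first by case=> ->.
by move=> rt; rewrite ltnS ltnW.
Qed.

(** Index [t] lies outside [past t], so an entry of [W t] can be adjoined and contributes its mean;
    afterwards [t] belongs to the past. *)
Lemma entry_decoupled t f i j : indep_of_future t f ->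
  indep_of_future t.+1 (fun w => f w * W t w i j) /\
  \int[P]_w (f w * W t w i j) = \int[P]_w f w * Wbar i j.
Proof.
move=> ft; have [|||h ->] := decoupled_mul (Y := fun w => W t w i j)
  gens_measurable gens_indep ft (past_notin t).
- by move=> B mB; exact: (@sigma_of_preimage _ _ _ _ _ (i, j) _ mB).
- exact: W_integrable.
- by apply: (intg_mul_bounded (c := 1) ft.1) => // w; exact: W_le1.
by rewrite W_mean; split=> //; exact: decoupledW (@pastS t) h.
Qed.

(** Two entries of the same matrix may be dependent, so their product is adjoined as one bounded
    variable of the class of index [t]. *)
Lemma entryM_decoupled t f i j i' j' : indep_of_future t f ->
  indep_of_future t.+1 (fun w => f w * (W t w i j * W t w i' j')).
Proof.
move=> ft; have WW : measurable_fun setT (fun w => W t w i j * W t w i' j').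
  exact: measurable_funM.
have WW1 w : `|W t w i j * W t w i' j'| <= 1.
  by rewrite normrM mulr_ile1 ?W_le1.
have [|||h _] := decoupled_mul (Y := fun w => W t w i j * W t w i' j')
  gens_measurable gens_indep ft (past_notin t).
- by move=> B mB; exact: (@sigma_of_preimageM _ _ _ _ _ (i, j) (i', j') _ mB).
- exact: intg_bounded WW WW1.
- exact: intg_mul_bounded ft.1 WW WW1.
exact: decoupledW (@pastS t) h.
Qed.

Lemma trajSE t w i j : x t.+1 w i j = \sum_k W t w i k * x t w k j.
Proof. by rewrite /x /= mxE. Qed.

(** One step of the dynamics with a fixed factor [g]: each new entry is a linear combination of
    products of an old entry, [g] and an entry of [W t]. *)
Lemma trajS_decoupled t g j :
  (forall k, indep_of_future t (fun w => x t w k j * g w)) -> forall i,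
  indep_of_future t.+1 (fun w => x t.+1 w i j * g w) /\
  \int[P]_w (x t.+1 w i j * g w) = \sum_k Wbar i k * \int[P]_w (x t w k j * g w).
Proof.
move=> xg i.
have E w : \sum_k (x t w k j * g w) * W t w i k = x t.+1 w i j * g w.
  by rewrite trajSE mulr_suml; apply: eq_bigr => k _; rewrite mulrC mulrA.
have F k := entry_decoupled i k (xg k).
split; first by apply: decoupled_ext E _; apply: decoupled_sum => // k; exact: (F k).1.
rewrite -(Rintegral_ext P E) Rintegral_sum; last by move=> k; exact: (F k).1.1.
by apply: eq_bigr => k _; rewrite (F k).2 mulrC.
Qed.

Lemma traj_decoupled t i j : indep_of_future t (fun w => x t w i j).
Proof.
elim: t i => [|t IH] i; first exact: (decoupled_cst P gens_measurable _ (x0 i j)).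
apply: (decoupled_ext (f := fun w => x t.+1 w i j * 1)) => [w|]; first by rewrite mulr1.
apply: (trajS_decoupled _ i).1 => k.
by apply: decoupled_ext (IH k) => w; rewrite mulr1.
Qed.

(** Both factors advance in time, so each is expanded, and pairs of entries of [W t] are adjoined
    together. *)
Lemma trajM_decoupled t i j i' j' :
  indep_of_future t (fun w => x t w i j * x t w i' j').
Proof.
elim: t i i' => [|t IH] i i'.
  exact: (decoupled_cst P gens_measurable _ (x0 i j * x0 i' j')).
apply: (decoupled_ext (f := fun w => \sum_k \sum_l
    (x t w k j * x t w l j') * (W t w i k * W t w i' l))) => [w|].
  rewrite !trajSE mulr_suml; apply: eq_bigr => k _; rewrite mulr_sumr.
  by apply: eq_bigr => l _; rewrite mulrACA; congr (_ * _); exact: mulrC.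
apply: decoupled_sum => // k; apply: decoupled_sum => // l.
exact: entryM_decoupled.
Qed.

Section centered.
Variable xinf : 'M[R]_(n, m).
Hypothesis xinf_fixed : Wbar *m xinf = xinf.
Variables (s : nat) (g : Omega -> R).
Hypothesis g_past : indep_of_future s g.
Hypothesis xg_past : forall i j, indep_of_future s (fun w => x s w i j * g w).

Let xg_decoupled k i j :
  indep_of_future (s + k) (fun w => x (s + k)%N w i j * g w).
Proof.
elim: k i => [|k IH] i; first by rewrite addn0.
by rewrite addnS; apply: (trajS_decoupled _ i).1.
Qed.

Let centeredE k i j : \int[P]_w ((x (s + k)%N w i j - xinf i j) * g w) =
  \int[P]_w (x (s + k)%N w i j * g w) - xinf i j * \int[P]_w g w.
Proof.
rewrite -RintegralZl//; last exact: g_past.1.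
rewrite -RintegralB//; [|exact: (xg_decoupled k i j).1|exact/intgZ/g_past.1].
by apply: Rintegral_ext => w; rewrite mulrBl.
Qed.

Definition centered_corr k : 'M[R]_(n, m) :=
  \matrix_(i, j) \int[P]_w ((x (s + k)%N w i j - xinf i j) * g w).

(** Because [Wbar] fixes [xinf], centering leaves the recursion homogeneous. *)
Lemma centered_corrS k : centered_corr k.+1 = Wbar *m centered_corr k.
Proof.
apply/matrixP => i j; rewrite !mxE centeredE addnS (trajS_decoupled _ i).2//.
rewrite -[in LHS]xinf_fixed mxE mulr_suml -sumrB; apply: eq_bigr => l _.
by rewrite mxE centeredE mulrBr mulrA.
Qed.

End centered.

End trajectories.

(** * Equality of means under equal laws, and the second moment of an average *)

Section moments.
Context (R : realType) (d : measure_display) (Omega : measurableType d).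
Variable P : probability Omega R.

(** A mean is an integral against the law of one coordinate, and events on one coordinate are
    generating cylinders. *)
Lemma Rintegral_same_law (K : Type) (X Y : Omega -> K -> R) k :
  same_law P X Y -> intg P (fun w => X w k) -> intg P (fun w => Y w k) ->
  \int[P]_w X w k = \int[P]_w Y w k.
Proof.
move=> XY Xi Yi.
pose RV f mf : {mfun Omega >-> R} :=
  MeasurableFun.Pack (MeasurableFun.Class (isMeasurableFun.Build _ _ _ _ f mf)).
pose X' := RV _ (intg_measurable Xi); pose Y' := RV _ (intg_measurable Yi).
have mE : measurable_fun [set: R] (@EFin R) by exact/measurable_EFinP.
have := integral_distribution (X := X') mE Xi.
have := integral_distribution (X := Y') mE Yi.
rewrite /Rintegral => /= <- <-; congr fine; apply: eq_measure_integral => B mB _.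
apply: (XY [set f | B (f k)]); apply: sub_sigma_algebra.
by exists k, B.
Qed.

(** The square expands into a double sum with prefactor [1 / N^2]; its [N] rows each contribute at
    most [a]. *)
Lemma Rintegral_sqr_mean_le (u : nat -> Omega -> R) (T : seq nat) a :
  T != [::] -> (forall t s, intg P (fun w => u t w * u s w)) ->
  (forall t, t \in T -> \sum_(s <- T) \int[P]_w (u t w * u s w) <= a) ->
  intg P (fun w => ((size T)%:R^-1 * \sum_(t <- T) u t w) ^+ 2) /\
  \int[P]_w ((size T)%:R^-1 * \sum_(t <- T) u t w) ^+ 2 <= (size T)%:R^-1 * a.
Proof.
move=> T0 ui ua; set N : R := (size T)%:R.
have N0 : 0 < N by rewrite ltr0n lt0n size_eq0.
have E w : N ^- 2 * \sum_(t <- T) \sum_(s <- T) u t w * u s w =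
    (N^-1 * \sum_(t <- T) u t w) ^+ 2.
  rewrite exprMn exprVn; congr (_ * _); rewrite expr2 mulr_suml.
  by apply: eq_bigr => t _; rewrite mulr_sumr.
have us t : intg P (fun w => \sum_(s <- T) u t w * u s w) by exact: intg_sum.
have uss : intg P (fun w => \sum_(t <- T) \sum_(s <- T) u t w * u s w).
  exact: intg_sum.
split; first by rewrite -(funext E); exact: intgZ.
rewrite -(Rintegral_ext P E) RintegralZl// Rintegral_sum//.
rewrite expr2 invfM -mulrA ler_wpM2l ?invr_ge0 ?ler0n// ler_pdivrMl// mulr_natl.
rewrite -iter_addr_0 -(count_predT T) -big_const_seq big_seq [leRHS]big_seq.
by apply: ler_sum => t tT; rewrite Rintegral_sum//; exact: ua.
Qed.

End moments.

(** * Bias and autocovariance of the centered opinions *)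

Section stubborn.
Context (R : realType) (d : measure_display) (Omega : measurableType d).
Variable P : probability Omega R.
Context (ns nd m : nat) (J : eqType) (G : J -> set (set Omega)).
Variables (B : nat -> Omega -> 'M[R]_(nd, ns)) (D : nat -> Omega -> 'M[R]_nd).
Variables (x0 : 'M[R]_(ns + nd, m)) (Bbar : 'M[R]_(nd, ns)) (Dbar : 'M[R]_nd).

Let W t w := Wmat (B t w) (D t w).

Hypothesis nd_gt0 : (0 < nd)%N.
Hypothesis W_measurable : forall t i j, measurable_fun setT (fun w => W t w i j).
Hypothesis W_stochastic : forall t w, row_stochastic (W t w).
Hypothesis indep : mutually_independent P (gens G W).
Hypothesis G_measurable : forall a A, gens G W a A -> measurable A.
Hypothesis W_mean : forall t i j, \int[P]_w W t w i j = Wmat Bbar Dbar i j.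
Hypothesis Dbar_lt1 : spec_norm Dbar < 1.

Let xinf := Winf Bbar Dbar *m x0.
Let x t w := traj (fun s => W s w) x0 t.
Let z t w i j := x t w i j - xinf i j.
Let b := \sum_i \sum_j `|x0 i j| + \sum_i \sum_j `|xinf i j|.

(** One constant for both recursions: [b] bounds [z] and starts that of the bias, [b ^+ 2] bounds
    products of two entries of [z] and starts that of the autocovariance. *)
Let C := Num.sqrt nd%:R * (b + b ^+ 2).
Let q := spec_norm Dbar.

Lemma xinf_fixed : Wmat Bbar Dbar *m xinf = xinf.
Proof. by rewrite mulmxA Wmat_Winf. Qed.

Let b_ge0 : 0 <= b.
Proof. by rewrite addr_ge0// sumr_ge0// => i _; rewrite sumr_ge0. Qed.

Let z_le t w i j : `|z t w i j| <= b.
Proof.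
rewrite (le_trans (ler_normB _ _))// lerD//; first exact: traj_le.
rewrite (bigD1 i)//= (bigD1 j)//= -addrA lerDl addr_ge0 ?sumr_ge0// => k _.
exact: sumr_ge0.
Qed.

(** Stubborn opinions never move, and [xinf] agrees with [x0] on their rows. *)
Let z_stubborn t w i j : z t w (lshift nd i) j = 0.
Proof.
have xE : usubmx (x t w) = usubmx x0.
  elim: t => // t IH; rewrite /x /= -/(x t w) -[x t w]vsubmxK /W /Wmat.
  by rewrite mul_block_col col_mxKu mul1mx mul0mx addr0.
have iE : usubmx xinf = usubmx x0.
  by rewrite /xinf /Winf -[x0 in LHS]vsubmxK mul_block_col col_mxKu mul1mx mul0mx addr0.
have E (A : 'M[R]_(ns + nd, m)) : A (lshift nd i) j = usubmx A i j by rewrite mxE.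
by rewrite /z !E xE iE subrr.
Qed.

Let z_decoupled t i j : decoupled P (gens G W) (past t) (fun w => z t w i j).
Proof.
apply: decoupledD => //; first exact: traj_decoupled.
exact: (decoupled_cst P G_measurable _ (- xinf i j)).
Qed.

Let xz_decoupled t i j i' j' :
  decoupled P (gens G W) (past t) (fun w => x t w i j * z t w i' j').
Proof.
apply: (decoupled_ext (f := fun w => x t w i j * x t w i' j' + - xinf i' j' * x t w i j)).
  by move=> w; rewrite /z; ring.
apply: decoupledD => //; first exact: trajM_decoupled.
by apply: decoupledZ => //; exact: traj_decoupled.
Qed.

(** [centered_corrS] is the iteration required by [Wmat_contraction], and [z_stubborn] makes the
    initial stubborn rows vanish. *)
Let centered_decay s g c k i j : 0 <= c ->
  decoupled P (gens G W) (past s) g ->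
  (forall i j, decoupled P (gens G W) (past s) (fun w => x s w i j * g w)) ->
  (forall i j, `|\int[P]_w (z s w i j * g w)| <= c) ->
  `|\int[P]_w (z (s + k)%N w i j * g w)| <= Num.sqrt nd%:R * c * q ^+ k.
Proof.
move=> c0 gs xgs zc; pose Z := centered_corr P W x0 xinf s g.
have ZE l i' j' : Z l i' j' = \int[P]_w (z (s + l)%N w i' j' * g w) by rewrite mxE.
rewrite -ZE; apply: (Wmat_contraction (B := Bbar) nd_gt0 c0) => [l||i' j'].
- exact: (centered_corrS W_measurable W_stochastic indep G_measurable W_mean xinf_fixed gs xgs).
- apply/matrixP => i' j'; transitivity (Z 0 (lshift nd i') j'); first by rewrite [LHS]mxE.
  rewrite ZE [RHS]mxE (Rintegral_ext P (g := fun=> 0)) ?Rintegral_cst1// => w.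
  by rewrite z_stubborn mul0r.
- by rewrite ZE addn0.
Qed.

Lemma z_measurable t i j : measurable_fun setT (fun w => z t w i j).
Proof. exact: intg_measurable (z_decoupled t i j).1. Qed.

Lemma z_integrable t i j : intg P (fun w => z t w i j).
Proof. exact: (z_decoupled t i j).1. Qed.

Lemma zM_integrable t s i j : intg P (fun w => z t w i j * z s w i j).
Proof. exact: (intg_mul_bounded (z_integrable t i j) (z_measurable s i j) (z_le s ^~ i ^~ j)). Qed.

Lemma mean_error t i j : `|\int[P]_w z t w i j| <= C * q ^+ t.
Proof.
have -> : \int[P]_w z t w i j = \int[P]_w (z (0 + t)%N w i j * 1).
  by apply: Rintegral_ext => w; rewrite mulr1.
apply: le_trans (centered_decay t i j b_ge0 (decoupled_cst P G_measurable _ 1) _ _) _.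
- move=> i' j'; apply: (decoupled_ext (f := fun w => x 0 w i' j')) => [w|].
    by rewrite mulr1.
  exact: traj_decoupled.
(* At time 0 the state is deterministic, so it may be evaluated at the arbitrary sample [point]. *)
- move=> i' j'; rewrite (Rintegral_ext P (g := fun=> z 0 point i' j')).
    by rewrite Rintegral_cst1.
  by move=> w; rewrite mulr1.
by rewrite ler_wpM2r ?exprn_ge0 ?spec_norm_ge0// ler_wpM2l// lerDl sqr_ge0.
Qed.

Lemma correlation t s i j :
  `|\int[P]_w (z t w i j * z s w i j)| <= C * q ^+ ((t - s) + (s - t)).
Proof.
(* By symmetry the earlier time is [s]; then [z s] serves as the past factor [g] and the lag is
   [t - s]. *)
wlog st : t s / (s <= t)%N.
  move=> H; case/orP: (leq_total s t) => [/H//|/H].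
  rewrite addnC (Rintegral_ext P (g := fun w => z t w i j * z s w i j))// => w.
  exact: mulrC.
have /eqP -> : (s - t == 0)%N by rewrite subn_eq0.
rewrite addn0 -{1}(subnKC st).
apply: le_trans (centered_decay (t - s) i j (sqr_ge0 b) (z_decoupled s i j) _ _) _.
- by move=> i' j'; exact: xz_decoupled.
- move=> i' j'; have zz : intg P (fun w => z s w i' j' * z s w i j).
    exact: (intg_mul_bounded (z_integrable s i' j') (z_measurable s i j) (z_le s ^~ i ^~ j)).
  apply: le_trans (le_normr_Rintegral measurableT zz) _.
  rewrite -[leRHS](Rintegral_cst1 P) le_Rintegral//; [exact: integrable_norm zz|exact: intg_cst|].
  by move=> w _; rewrite normrM expr2 ler_pM.
by rewrite ler_wpM2r ?exprn_ge0 ?spec_norm_ge0// ler_wpM2l// lerDr.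
Qed.

Lemma zM_indep_integrable t i j Y : intg P Y -> intg P (fun w => z t w i j * Y w).
Proof.
move=> Yi; rewrite (_ : (fun _ => _) = fun w => Y w * z t w i j); last first.
  by apply/funext => w; rewrite mulrC.
exact: (intg_mul_bounded Yi (z_measurable t i j) (z_le t ^~ i ^~ j)).
Qed.

(** The index [inr a] of the noise is outside every past, so the expectation factors. *)
Lemma z_noise_uncorrelated t i j (a : J) Y :
  (forall A : set R, measurable A -> G a (Y @^-1` A)) -> intg P Y ->
  \int[P]_w Y w = 0 -> \int[P]_w (z t w i j * Y w) = 0.
Proof.
move=> GY Yi Y0; have zY := zM_indep_integrable t i j Yi.
have [_ ->] := decoupled_mul G_measurable indep (i := inr a) (z_decoupled t i j) isT GY Yi zY.
by rewrite Y0 mulr0.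
Qed.

End stubborn.

(** * Entrywise control of the Frobenius norm, and decay of powers *)

Section auxiliary_estimates.
Context (R : realType).

Lemma frob_norm_le p q (A : 'M[R]_(p, q)) delta : 0 <= delta ->
  (forall i j, `|A i j| <= delta) -> frob_norm A <= Num.sqrt (p * q)%:R * delta.
Proof.
move=> d0 Ad; rewrite -[X in _ * X]ger0_norm// -sqrtr_sqr -sqrtrM ?ler0n//.
rewrite /frob_norm ler_sqrt; last by rewrite mulr_ge0 ?sqr_ge0 ?ler0n.
apply: (@le_trans _ _ (\sum_(i < p) \sum_(j < q) delta ^+ 2)).
  apply: ler_sum => i _; apply: ler_sum => j _.
  by rewrite -real_normK ?num_real// lerXn2r ?nnegrE.
by rewrite !sumr_const !card_ord -mulrnA mulr_natl mulnC.
Qed.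

Lemma exists_expr_le (q M eps : R) : 0 <= q -> q < 1 -> 0 < eps ->
  exists n : nat, M * q ^+ n <= eps.
Proof.
move=> q0 q1 e0; have : M * q ^+ n @[n --> \oo] --> M * 0.
  by apply: cvgMr; apply: cvg_expr; rewrite ger0_norm.
rewrite mulr0 => /cvgr0Pnorm_le /(_ _ e0) [n _ /(_ n (leqnn n)) /=].
by move=> h; exists n; exact: le_trans (ler_norm _) h.
Qed.

End auxiliary_estimates.

(** * Mean matrices and square-integrable noise *)

Section mean_matrices.
Context (R : realType) (d : measure_display) (Omega : measurableType d).
Variable P : probability Omega R.

Lemma mean_mxE p q (X : Omega -> 'M[R]_(p, q)) i j :
  mean_mx P X i j = \int[P]_w X w i j.
Proof. by rewrite mxE unlock. Qed.

Lemma Wmat_measurable ns nd (B : Omega -> 'M[R]_(nd, ns)) (D : Omega -> 'M[R]_nd) :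
  (forall i j, measurable_fun setT (fun w => B w i j)) ->
  (forall i j, measurable_fun setT (fun w => D w i j)) ->
  forall i j, measurable_fun setT (fun w => Wmat (B w) (D w) i j).
Proof.
move=> mB mD i j; rewrite /Wmat.
case: (split_ordP i) => i' ->; case: (split_ordP j) => j' ->.
- under eq_fun do rewrite block_mxEul; exact: measurable_cst.
- under eq_fun do rewrite block_mxEur; exact: measurable_cst.
- under eq_fun do rewrite block_mxEdl; exact: mB.
- under eq_fun do rewrite block_mxEdr; exact: mD.
Qed.

Lemma Rintegral_Wmat ns nd (B : Omega -> 'M[R]_(nd, ns)) (D : Omega -> 'M[R]_nd) i j :
  \int[P]_w Wmat (B w) (D w) i j = Wmat (mean_mx P B) (mean_mx P D) i j.
Proof.
rewrite /Wmat; case: (split_ordP i) => i' ->; case: (split_ordP j) => j' ->.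
- by rewrite block_mxEul -[RHS](Rintegral_cst1 P); apply: Rintegral_ext => w; rewrite block_mxEul.
- by rewrite block_mxEur -[RHS](Rintegral_cst1 P); apply: Rintegral_ext => w; rewrite block_mxEur.
- by rewrite block_mxEdl mean_mxE; apply: Rintegral_ext => w; rewrite block_mxEdl.
- by rewrite block_mxEdr mean_mxE; apply: Rintegral_ext => w; rewrite block_mxEdr.
Qed.

Lemma Lfun2_integrable (X : Omega -> R) : X \in Lfun P 2%:E -> intg P X.
Proof.
move=> X2; apply/Lfun1_integrable; apply: Lfun_subset12 X2.
by rewrite fin_num_measure.
Qed.

Lemma Lfun2_integrableM (X Y : Omega -> R) :
  X \in Lfun P 2%:E -> Y \in Lfun P 2%:E -> intg P (fun w => X w * Y w).
Proof. by move=> X2 Y2; apply/Lfun1_integrable; exact: Lfun2_mul_Lfun1. Qed.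

Lemma Rintegral_sqr_le_variance (X : Omega -> R) v :
  X \in Lfun P 2%:E -> 'E_P[X]%E = 0%E -> ('V_P[X] <= v%:E)%E ->
  \int[P]_w (X w * X w) <= v.
Proof.
move=> X2 X0; rewrite varianceE// X0 expe2 mule0 sube0 unlock.
have XX := integrable_fin_num measurableT (Lfun2_integrableM X2 X2).
by rewrite -lee_fin /Rintegral fineK.
Qed.

End mean_matrices.

(** * Bias and mean square error of the sample average *)

Section estimator.
Context (R : realType) (d : measure_display) (Omega : measurableType d).
Variable P : probability Omega R.
Context (n m : nat) (x N : nat -> Omega -> 'M[R]_(n, m)) (xinf : 'M[R]_(n, m)).
Let err t w i j := x t w i j - xinf i j.
Let xh T w := xhat (x ^~ w) (N ^~ w) T.

Hypothesis err_integrable : forall t i j, intg P (fun w => err t w i j).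
Hypothesis errM_integrable :
  forall t s i j, intg P (fun w => err t w i j * err s w i j).
Hypothesis errN_integrable : forall t s i j, intg P (fun w => err t w i j * N s w i j).
Hypothesis NN_integrable : forall t s i j, intg P (fun w => N t w i j * N s w i j).
Hypothesis N_integrable : forall t i j, intg P (fun w => N t w i j).
Hypothesis N_mean0 : forall t i j, \int[P]_w N t w i j = 0.
Hypothesis errN0 : forall t s i j, \int[P]_w (err t w i j * N s w i j) = 0.
Hypothesis NN0 : forall t s i j, t != s -> \int[P]_w (N t w i j * N s w i j) = 0.
Variables (C q sigma2 : R).
Hypotheses (C_ge0 : 0 <= C) (q_ge0 : 0 <= q) (q_lt1 : q < 1).
Hypothesis NN_le : forall t i j, \int[P]_w (N t w i j * N t w i j) <= sigma2.
Hypothesis mean_le : forall t i j, `|\int[P]_w err t w i j| <= C * q ^+ t.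
Hypothesis corr_le : forall t s i j,
  \int[P]_w (err t w i j * err s w i j) <= C * q ^+ ((t - s) + (s - t)).

(** The deviation of a single observation from [xinf]. *)
Let u t w i j := err t w i j + N t w i j.

Lemma xhat_errE T w i j : T != [::] ->
  (xh T w - xinf) i j = (size T)%:R^-1 * \sum_(t <- T) u t w i j.
Proof.
move=> T0; have N0 : (size T)%:R != 0 :> R by rewrite pnatr_eq0 size_eq0.
rewrite !mxE summxE.
have -> : xinf i j = (size T)%:R^-1 * \sum_(t <- T) xinf i j.
  by rewrite big_const_seq count_predT iter_addr_0 -(mulr_natl (xinf i j)) mulKf.
rewrite -mulrBr -sumrB; congr (_ * _); apply: eq_bigr => t _.
by rewrite !mxE /u /err; ring.
Qed.

Lemma u_integrable t i j : intg P (fun w => u t w i j).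
Proof. exact: intgD. Qed.

(** The noise averages out, leaving a mean of terms [C q^t] with [t] at least [T0]. *)
Lemma bias_le T T0 i j : T != [::] -> (forall t, t \in T -> (T0 <= t)%N) ->
  `|(mean_mx P (xh T) - xinf) i j| <= C * q ^+ T0.
Proof.
move=> Tn0 TT0; have N0 : 0 < (size T)%:R :> R by rewrite ltr0n lt0n size_eq0.
have su : intg P (fun w => \sum_(t <- T) u t w i j).
  by apply: (intg_sum _ (F := fun t w => u t w i j)) => t; exact: u_integrable.
have -> : (mean_mx P (xh T) - xinf) i j =
    (size T)%:R^-1 * \sum_(t <- T) \int[P]_w err t w i j.
  have xhE w : xh T w i j = (size T)%:R^-1 * \sum_(t <- T) u t w i j + xinf i j.
    by rewrite -xhat_errE// [X in _ = X + _]mxE [X in _ = _ + X + _]mxE subrK.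
  rewrite [LHS]mxE [X in _ + X]mxE mean_mxE (Rintegral_ext P xhE).
  rewrite RintegralD//; [|exact: intgZ|exact: intg_cst].
  rewrite Rintegral_cst1 addrK RintegralZl// Rintegral_sum => [|t]; last exact: u_integrable.
  congr (_ * _); apply: eq_bigr => t _.
  by rewrite (RintegralD measurableT (err_integrable t i j) (N_integrable t i j)) N_mean0 addr0.
rewrite normrM ger0_norm ?invr_ge0 ?ler0n// ler_pdivrMl//.
rewrite mulr_natl -iter_addr_0 -(count_predT T) -big_const_seq.
apply: le_trans (ler_norm_sum _ _ _) _; rewrite big_seq [leRHS]big_seq.
apply: ler_sum => t tT; apply: le_trans (mean_le t i j) _.
by rewrite ler_wpM2l// ler_wiXn2l ?TT0// ltW.
Qed.

Let uuE t s i j w : err t w i j * err s w i j + err t w i j * N s w i j +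
  (err s w i j * N t w i j + N t w i j * N s w i j) = u t w i j * u s w i j.
Proof. by rewrite /u; ring. Qed.

Lemma uM_integrable t s i j : intg P (fun w => u t w i j * u s w i j).
Proof.
rewrite -(funext (uuE t s i j)).
by apply: intgD; apply: intgD; [exact: errM_integrable|exact: errN_integrable
  |exact: errN_integrable|exact: NN_integrable].
Qed.

Lemma uM_le t s i j : \int[P]_w (u t w i j * u s w i j) <=
  C * q ^+ ((t - s) + (s - t)) + (t == s)%:R * sigma2.
Proof.
rewrite -(Rintegral_ext P (uuE t s i j)).
have ee := errM_integrable t s i j; have eN := errN_integrable t s i j.
have Ne := errN_integrable s t i j; have NN := NN_integrable t s i j.
rewrite RintegralD//; [|exact: intgD ee eN|exact: intgD Ne NN].
rewrite !RintegralD// !errN0 addr0 add0r lerD//.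
by case: eqP => [<-|/eqP ts]; rewrite ?mul1r// mul0r NN0.
Qed.

(** For fixed [t], the correlations sum to a geometric bound, while the noise variance enters only
    at [s = t], once since the times are distinct. *)
Lemma mean_square_le T i j : uniq T -> T != [::] ->
  intg P (fun w => (xh T w - xinf) i j ^+ 2) /\
  \int[P]_w ((xh T w - xinf) i j ^+ 2) <=
    (size T)%:R^-1 * (C * (2 / (1 - q)) + sigma2).
Proof.
move=> uT Tn0.
have E w : ((size T)%:R^-1 * \sum_(t <- T) u t w i j) ^+ 2 = (xh T w - xinf) i j ^+ 2.
  by rewrite xhat_errE.
rewrite -(funext E).
apply: (Rintegral_sqr_mean_le (u := fun t w => u t w i j)) => // [t s|t tT].
  exact: uM_integrable.
apply: (@le_trans _ _
    (\sum_(s <- T) (C * q ^+ ((t - s) + (s - t)) + (t == s)%:R * sigma2))).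
  by apply: ler_sum => s _; exact: uM_le.
rewrite big_split/= lerD//; first by rewrite -mulr_sumr ler_wpM2l// sum_expr_dist_le.
rewrite (bigD1_seq t)//= eqxx mul1r big1 ?addr0// => s.
by rewrite eq_sym => /negPf ->; rewrite mul0r.
Qed.

Lemma frob_mean_square_le T : uniq T -> T != [::] ->
  ('E_P[fun w => (frob_norm (xh T w - xinf) ^+ 2)%R] <=
    ((n * m)%:R * ((size T)%:R^-1 * (C * (2 / (1 - q)) + sigma2)))%:E)%E.
Proof.
move=> uT Tn0; set a := _ * (_ + _).
have E w : \sum_i \sum_j (xh T w - xinf) i j ^+ 2 = frob_norm (xh T w - xinf) ^+ 2.
  by rewrite sqr_sqrtr// sumr_ge0// => i _; rewrite sumr_ge0// => j _; exact: sqr_ge0.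
have rows i : intg P (fun w => \sum_j (xh T w - xinf) i j ^+ 2).
  by apply: intg_sum => j; exact: (mean_square_le i j uT Tn0).1.
have all : intg P (fun w => \sum_i \sum_j (xh T w - xinf) i j ^+ 2) by exact: intg_sum.
(* Integrability makes the extended expectation finite, so the estimate becomes one between real
   integrals. *)
rewrite -(funext E) unlock -(fineK (integrable_fin_num measurableT all)) lee_fin.
rewrite -/(Rintegral P setT (fun w => \sum_i \sum_j (xh T w - xinf) i j ^+ 2)).
rewrite Rintegral_sum//; apply: (@le_trans _ _ (\sum_(i < n) \sum_(j < m) a)).
  apply: ler_sum => i _; rewrite Rintegral_sum => [|j].
    by apply: ler_sum => j _; exact: (mean_square_le i j uT Tn0).2.
  exact: (mean_square_le i j uT Tn0).1.
by rewrite !sumr_const !card_ord -mulrnA mulr_natl mulnC.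
Qed.

End estimator.

(** * Asymptotic unbiasedness and consistency *)

Unset Implicit Arguments.

Theorem theorem2 (R : realType) (d : measure_display) (Omega : measurableType d)
  (P : probability Omega R) (ns nd m : nat)
  (B : nat -> Omega -> 'M[R]_(nd, ns)) (D : nat -> Omega -> 'M[R]_nd)
  (N : nat -> Omega -> 'M[R]_(ns + nd, m)) (x0 : 'M[R]_(ns + nd, m)) (sigma : R) :
  (* 1 <= n_s < n = n_s + n_d, m >= 1 *)
  (0 < ns)%N -> (0 < nd)%N -> (0 < m)%N ->
  (* W(t) = [[I, 0], [B(t), D(t)]] are random, row-stochastic *)
  (forall t i j, measurable_fun setT (fun w => B t w i j)) ->
  (forall t i j, measurable_fun setT (fun w => D t w i j)) ->
  (forall t w, row_stochastic (Wmat (B t w) (D t w))) ->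
  (* identically distributed *)
  (forall t, same_law P (Wvec (B t) (D t)) (Wvec (B 0%N) (D 0%N))) ->
  (* ||Dbar||_2 < 1 and ||Dbar||_2 = E ||D(t)||_2, Dbar = E D(t) *)
  spec_norm (mean_mx P (D 0%N)) < 1 ->
  (forall t, 'E_P[fun w => spec_norm (D t w)]%E = (spec_norm (mean_mx P (D 0%N)))%:E) ->
  (* noise: zero mean, variance <= sigma^2 *)
  (forall t i j, (fun w => N t w i j) \in Lfun P 2%:E) ->
  (forall t i j, 'E_P[fun w => N t w i j]%E = 0%E) ->
  (forall t i j, ('V_P[fun w => N t w i j] <= (sigma ^+ 2)%:E)%E) ->
  (* entries of each n(t) identically distributed *)
  (forall t i j i' j', same_law P (fun w (_ : unit) => N t w i j)
                                  (fun w (_ : unit) => N t w i' j')) ->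
  (* independence: the W(t) and all the noise entries are mutually
     independent (so the W(t) are independent, the noise entries are
     independent, and the noise is independent of {W(t)}) *)
  mutually_independent P
    (fun a : (nat + (nat * 'I_(ns + nd) * 'I_m))%type =>
       match a with
       | inl t => sigma_of (Wvec (B t) (D t))
       | inr p => sigma_of (fun w (_ : unit) => N p.1.1 w p.1.2 p.2)
       end) ->
  let Bbar := mean_mx P (B 0%N) in
  let Dbar := mean_mx P (D 0%N) in
  let xinf := Winf Bbar Dbar *m x0 in
  let x := fun t w => traj (fun s => Wmat (B s w) (D s w)) x0 t in
  let xh := fun (T : seq nat) w => xhat (fun t => x t w) (fun t => N t w) T in
  (* (1) unbiased as T_o -> oo *)
  (forall eps : R, 0 < eps -> exists To : nat,
     forall T : seq nat, uniq T -> T != [::] -> (forall t, t \in T -> (To <= t)%N) ->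
       frob_norm (mean_mx P (xh T) - xinf) <= eps)
  /\
  (* (2) consistent: lim_{T_o -> oo} lim_{|T_s| -> oo} E ||xhat - xinf||_F^2 = 0 *)
  (forall eps : R, 0 < eps -> exists (To Nmin : nat),
     forall T : seq nat, uniq T -> T != [::] -> (Nmin <= size T)%N ->
       (forall t, t \in T -> (To <= t)%N) ->
       ('E_P[fun w => (frob_norm (xh T w - xinf) ^+ 2)%R] <= eps%:E)%E).
Proof.
move=> _ nd_gt0 _ mB mD Wst same D1 _ NL2 N0 NV _ indep Bbar Dbar xinf x xh.
pose W t w := Wmat (B t w) (D t w).
pose G (p : nat * 'I_(ns + nd) * 'I_m) := sigma_of (fun w (_ : unit) => N p.1.1 w p.1.2 p.2).
have Wm t i j : measurable_fun setT (fun w => W t w i j).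
  exact: Wmat_measurable.
have Ni t i j : intg P (fun w => N t w i j) by exact: Lfun2_integrable.
(* The assumed family of classes is [gens G W] up to conversion. *)
have indepG : mutually_independent P (gens G W) := indep.
have mG a A : gens G W a A -> measurable A.
  case: a => [t|p]; apply: sigma_of_measurable => k; first exact: Wm.
  exact: intg_measurable (Ni _ _ _).
(* Equality in law with time 0 gives every [W t] the same mean. *)
have W_mean t i j : \int[P]_w W t w i j = Wmat Bbar Dbar i j.
  rewrite -Rintegral_Wmat.
  apply: (Rintegral_same_law (k := (i, j)) (same t)); exact: (W_integrable P Wm Wst).
have GN p (A : set R) : measurable A -> G p ((fun w => N p.1.1 w p.1.2 p.2) @^-1` A).
  by move=> mA; exact: (@sigma_of_preimage _ _ _ _ _ tt _ mA).
have N_mean t i j : \int[P]_w N t w i j = 0.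
  by have := N0 t i j; rewrite unlock /Rintegral => ->.
pose z t w i j := x t w i j - xinf i j.
have zi t i j : intg P (fun w => z t w i j).
  exact: (z_integrable x0 Wm Wst indepG mG W_mean).
have NNi t s i j : intg P (fun w => N t w i j * N s w i j) by exact: Lfun2_integrableM.
have zN t s i j : \int[P]_w (z t w i j * N s w i j) = 0.
  exact: (z_noise_uncorrelated x0 Wm Wst indepG mG W_mean t i j (GN (s, i, j)) (Ni s i j)).
have NN t s i j : t != s -> \int[P]_w (N t w i j * N s w i j) = 0.
  move=> ts; rewrite (Rintegral_mul_indep mG indepG (i := inr (t, i, j)) (j := inr (s, i, j)))//.
  - by rewrite N_mean mul0r.
  - by apply: contra ts => /eqP[->].
  - exact: (GN (t, i, j)).
  - exact: (GN (s, i, j)).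
have NN_le t i j : \int[P]_w (N t w i j * N t w i j) <= sigma ^+ 2.
  exact: Rintegral_sqr_le_variance.
have q0 : 0 <= spec_norm Dbar by exact: spec_norm_ge0.
have zNi t s i j : intg P (fun w => z t w i j * N s w i j).
  exact: (zM_indep_integrable x0 Wm Wst indepG mG W_mean t i j (Ni s i j)).
have zzi t s i j : intg P (fun w => z t w i j * z s w i j).
  exact: (zM_integrable x0 Wm Wst indepG mG W_mean t s i j).
(* These are the constants in [mean_error] and [correlation]. *)
pose b := \sum_i \sum_j `|x0 i j| + \sum_i \sum_j `|xinf i j|.
pose C := Num.sqrt nd%:R * (b + b ^+ 2).
have C0 : 0 <= C.
  rewrite mulr_ge0// addr_ge0 ?sqr_ge0// addr_ge0//.
    by apply: sumr_ge0 => i _; apply: sumr_ge0.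
  by apply: sumr_ge0 => i _; apply: sumr_ge0.
have mean_le t i j : `|\int[P]_w z t w i j| <= C * spec_norm Dbar ^+ t.
  exact: (mean_error x0 nd_gt0 Wm Wst indepG mG W_mean D1).
have corr_le t s i j : \int[P]_w (z t w i j * z s w i j) <=
    C * spec_norm Dbar ^+ ((t - s) + (s - t)).
  apply: le_trans (ler_norm _) _.
  exact: (correlation x0 nd_gt0 Wm Wst indepG mG W_mean D1).
split=> eps eps0.
  (* The square root of the number of entries converts the entrywise bias bound into a Frobenius
     bound. *)
  have [To hTo] := exists_expr_le (Num.sqrt ((ns + nd) * m)%:R * C) q0 D1 eps0.
  exists To => T uT Tn0 TTo; apply: le_trans hTo; rewrite -mulrA.
  apply: frob_norm_le; first by rewrite mulr_ge0 ?exprn_ge0.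
  by move=> i j; exact: (bias_le zi Ni N_mean C0 q0 D1 mean_le).
pose M := ((ns + nd) * m)%:R * (C * (2 / (1 - spec_norm Dbar)) + sigma ^+ 2).
(* The bound [M / size T] is uniform in the sampling times, whence the witness 0; the other witness
   makes the sample size exceed [M / eps]. *)
exists 0, (Num.truncn (M / eps)).+1 => T uT Tn0 NT _.
have := frob_mean_square_le zzi zNi NNi zN NN C0 q0 D1 NN_le corr_le uT Tn0.
move/le_trans; apply.
rewrite lee_fin mulrCA -/M mulrC ler_pdivrMr; last by rewrite ltr0n lt0n size_eq0.
rewrite mulrC -ler_pdivrMr// ltW// (lt_le_trans (truncnS_gt _))//.
by rewrite ler_nat.
Qed.
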